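(* Let $Z=\sum_{i=1}^nX_i$, where $X_1,\dots,X_n$ are independent and nonnegative random variables. Then for all integers $q\ge1$ and all $\theta\in(0,1)$, $$\|(Z-\mathbb{E}[Z])_+\|_q\le\sqrt{2\kappa q\,\Bigl\|\max_i|X_i|\Bigr\|_q\,\mathbb{E}[Z]}+\kappa q\,\Bigl\|\max_i|X_i|\Bigr\|_q,$$ $$\|(Z-\mathbb{E}[Z])_-\|_q\le\sqrt{Kq\sum_{i=1}^n\mathbb{E}[X_i^2]}$$ and $$\|Z\|_q\le(1+\theta)\,\mathbb{E}[Z]+\frac{\kappa}{2}\,q\Bigl(1+\frac1\theta\Bigr)\Bigl\|\max_{1\le i\le n}X_i\Bigr\|_q .$$
   Context: $x_+=\max(x,0)$, $x_-=\max(-x,0)$, $\|Y\|_q=(\mathbb{E}|Y|^q)^{1/q}$ (possibly $+\infty$), $\kappa=\frac{\sqrt e}{2(\sqrt e-1)}<1.271$ and $K=\frac1{e-\sqrt e}<0.935$. The $X_i$ are real-valued and integrable, so that $\mathbb{E}[Z]$ is finite. *)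

(* Defs.v *)
From HB Require Import structures.
From mathcomp Require Import all_boot all_order all_algebra.
From mathcomp Require Import all_classical all_reals all_analysis.

Set Implicit Arguments.
Unset Strict Implicit.
Unset Printing Implicit Defensive.

Import Order.TTheory GRing.Theory Num.Theory.
Import numFieldNormedType.Exports.

Local Open Scope classical_set_scope.
Local Open Scope ring_scope.

Definition kappa (R : realType) : R :=
  Num.sqrt (expR 1) / (2 * (Num.sqrt (expR 1) - 1)).

Definition bigK (R : realType) : R := (expR 1 - Num.sqrt (expR 1))^-1.

(* Mutual (not merely pairwise) independence: the product rule holds for every
   subfamily J and every choice of Borel sets. *)
Definition mutually_independent (d : measure_display) (T : measurableType d)
    (R : realType) (P : probability T R) (I : finType)
    (X : I -> {RV P >-> R}) : Prop :=
  forall (J : {set I}) (A : I -> set R),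
    (forall i, i \in J -> measurable (A i)) ->
    P [set w | forall i, i \in J -> A i (X i w)] =
    (\prod_(i in J) P (X i @^-1` A i))%E.

Arguments mutually_independent {d T R} P {I} X.

(* For q >= 1, (E |Y|^q)^(1/q) as an extended real; it equals +oo when |Y|^q is not
   integrable. *)
Definition qnorm (d : measure_display) (T : measurableType d)
    (R : realType) (P : probability T R) (q : nat) (Y : T -> R) : \bar R :=
  ('N[P]_(q%:R%:E)[EFin \o Y])%E.

Arguments qnorm {d T R} P q Y.

(* Main.v *)
Require Import Defs.
From HB Require Import structures.
From mathcomp Require Import all_boot all_order all_algebra.
From mathcomp Require Import all_classical all_reals all_analysis.
From mathcomp Require Import measurable_realfun.
From mathcomp Require Import lra ring.

Set Implicit Arguments.
Unset Strict Implicit.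
Unset Printing Implicit Defensive.

Import Order.TTheory GRing.Theory Num.Theory.
Import numFieldNormedType.Exports.

Local Open Scope classical_set_scope.
Local Open Scope ring_scope.

(** The proof tests the centered sum against increasing functions of the sum
itself, which brings in neither entropy nor symmetrization.  Write mu = E Z,
D = (Z - mu)_+, M for a common upper bound of the X_i (such as their maximum),
m and x for the q-norms of M and D.

_Upper tail._  Let phi >= 0 be nondecreasing.  Since X_i is independent of
Z - X_i and phi (Z - X_i) <= phi Z, writing
Z phi(Z) = sum_i X_i phi(Z - X_i) + sum_i X_i (phi(Z) - phi(Z - X_i))
gives [decoupling_inequality]:
E (Z phi(Z)) <= mu E phi(Z) + E (sum_i X_i (phi(Z) - phi(Z - X_i))).
The choice phi(z) = (z - mu)_+^q / z makes everything explicit.  On the left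
Z phi(Z) - mu phi(Z) = D^(q+1) / Z.  On the right the increments satisfy
phi(z) - phi(z - t) <= t q (z - mu)_+^(q-1) / z, so that the sum is at most
q M D^(q-1) (X_i^2 <= M X_i, and the X_i add up to Z).  Hence
E (D^(q+1) / Z) <= q E (M D^(q-1)) <= q m x^(q-1), the last step being Young's
inequality.  The division by Z is paid back by
2 D^q <= a D^(q+1) / Z + Z D^(q-1) / a where Z = D + mu if D > 0; with
a = x / (q m) this becomes the quadratic inequality
x^2 <= q m (x + mu)                                  [excess_norm_quadratic]
which holds for all q >= 1 alike.  Solving it gives x <= sqrt (q m mu) + q m,
and, as theta <= 1, x <= theta mu + (q m / 2) (1 + 1/theta); the bound on the
norm of Z follows by Minkowski's inequality since Z <= D + mu.  Both are
stronger than the announced bounds because kappa >= 1.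

_Lower tail._  From exp(-y) <= 1 - y + y^2 for y >= 0 and independence,
E exp(l (mu - Z)) <= exp(l^2 v) with v = sum_i E X_i^2.  Inserting
y_+^q <= (q / (e l))^q exp(l y) and l^2 = q / (2 v) gives
E (mu - Z)_+^q <= (2 q v / e)^(q/2), and 2 / e <= K.

Both numerical facts, kappa >= 1 and K >= 2 / e, amount to sqrt e <= 2.

Nonnegativity almost everywhere is reduced to nonnegativity everywhere by
passing to positive parts, and an infinite norm of the maximum or an infinite
second moment makes the corresponding right-hand side infinite. *)

(** * Inequalities for real numbers *)

Section real_inequalities.
Variable R : realType.
Implicit Types (u v x y z mu l : R) (k : nat).

(** Unnormalized Young inequality.  The induction step adds the rearrangement
    (u^(k+1) - v^(k+1)) (u - v) >= 0 to v times the previous case. *)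
Lemma young_pow u v k : 0 <= u -> 0 <= v ->
  k.+1%:R * (u * v ^+ k) <= u ^+ k.+1 + k%:R * v ^+ k.+1.
Proof.
move=> u0 v0; elim: k => [|k IH]; first by rewrite !mul1r !expr1 mul0r addr0 mulr1.
have := ler_wpM2r v0 IH.
have : 0 <= (u ^+ k.+1 - v ^+ k.+1) * (u - v).
  have [uv|vu] := leP u v.
    by rewrite mulr_le0// subr_le0// lerXn2r.
  by rewrite mulr_ge0// subr_ge0 ?lerXn2r// ltW.
rewrite -[k.+2%:R]natr1 -[k.+1%:R in X in _ -> _ -> _ <= X]natr1 !exprS; nra.
Qed.

Definition excess mu z : R := Num.max (z - mu) 0.

Lemma excess_ge0 mu z : 0 <= excess mu z.
Proof. by rewrite le_max lexx orbT. Qed.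

Lemma excess_eq0 mu z : z <= mu -> excess mu z = 0.
Proof. by move=> zmu; apply/max_idPr; rewrite subr_le0. Qed.

Lemma excess_gt0 mu z : mu < z -> excess mu z = z - mu.
Proof. by move=> zmu; apply/max_idPl; rewrite subr_ge0 ltW. Qed.

Lemma excess_homo mu : {homo excess mu : y z / y <= z}.
Proof. by move=> y z yz; rewrite /excess ge_max !le_max lexx orbT lerD2r yz. Qed.

(** The test function of the upper tail.  Since excess mu z vanishes for
    z <= mu, the convention 0^-1 = 0 is harmless as soon as mu >= 0. *)
Definition relative_excess k mu z : R := excess mu z ^+ k.+1 / z.

Lemma relative_excess_ge0 k mu z : 0 <= mu -> 0 <= relative_excess k mu z.
Proof.
move=> mu0; rewrite /relative_excess; have [zmu|muz] := leP z mu.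
  by rewrite excess_eq0// expr0n mul0r.
by rewrite divr_ge0// ?exprn_ge0 ?excess_ge0// ltW// (le_lt_trans mu0).
Qed.

(** Above mu this is the product of the nondecreasing functions (z - mu)^k and
    1 - mu / z. *)
Lemma relative_excess_homo k mu : 0 <= mu ->
  {homo relative_excess k mu : y z / y <= z}.
Proof.
move=> mu0 y z yz; have [ymu|muy] := leP y mu.
  by rewrite {1}/relative_excess excess_eq0// expr0n mul0r relative_excess_ge0.
have y0 : 0 < y by exact: le_lt_trans muy.
have z0 : 0 < z by exact: lt_le_trans yz.
rewrite /relative_excess !exprSr -!mulrA ler_pM//.
- by rewrite exprn_ge0// excess_ge0.
- by rewrite divr_ge0 ?excess_ge0// ltW.
- by rewrite lerXn2r ?nnegrE ?excess_ge0//; exact: excess_homo.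
- rewrite ler_pdivrMr// mulrAC ler_pdivlMr//.
  by rewrite !excess_gt0// ?(lt_le_trans muy)//; nra.
Qed.

(** Replacing the denominator z - x by z only decreases the subtracted term, so
    the increment is at most the one of (z - mu)_+^(k+1) divided by z; Young's
    inequality bounds the latter like the mean value theorem would. *)
Lemma relative_excess_lip k mu x z : 0 <= mu -> 0 <= x <= z ->
  relative_excess k mu z - relative_excess k mu (z - x) <=
  x * (k.+1%:R * excess mu z ^+ k / z).
Proof.
move=> mu0 /andP[x0 xz].
have [z0|z0] := leP z 0.
  have -> : x = 0 by lra.
  by rewrite subr0 subrr mul0r.
(* If z - x <= 0 then the excess at z - x is zero. *)
have lb : excess mu (z - x) ^+ k.+1 / z <= relative_excess k mu (z - x).
  rewrite /relative_excess; have [zx|zx] := leP (z - x) 0.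
    by rewrite excess_eq0 ?expr0n ?mul0r// (le_trans zx).
  rewrite ler_wpM2l ?exprn_ge0 ?excess_ge0// lef_pV2 ?posrE//.
  by rewrite lerBlDr lerDl.
apply: le_trans (lerB (lexx _) lb) _; rewrite /relative_excess -mulrBl mulrA.
rewrite ler_pM2r ?invr_gt0//.
have Dk0 := exprn_ge0 k (excess_ge0 mu z).
have D_lip : excess mu z - excess mu (z - x) <= x.
  rewrite /excess; have [?|?] := leP (z - mu) 0; have [?|?] := leP (z - x - mu) 0; lra.
have := @young_pow _ _ k (excess_ge0 mu (z - x)) (excess_ge0 mu z).
have /(ler_wpM2r Dk0) := D_lip; move/(ler_wpM2l (ler0n R k.+1)).
rewrite -[k.+1%:R in X in _ -> X -> _]natr1.
rewrite -[k.+1%:R in X in X -> _ -> _]natr1.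
rewrite -natr1 !exprS; nra.
Qed.

(** For z > mu this is (z - mu) + mu = z, multiplied by (z - mu)^(k+1) / z. *)
Lemma relative_excess_split k mu z : 0 <= mu ->
  excess mu z ^+ k.+1 = relative_excess k.+1 mu z + mu * relative_excess k mu z.
Proof.
move=> mu0; rewrite /relative_excess; have [zmu|muz] := leP z mu.
  by rewrite excess_eq0// !expr0n !mul0r mulr0 addr0.
have z0 : z != 0 by rewrite gt_eqF// (le_lt_trans mu0).
rewrite mulrA -mulrDl (exprS _ k.+1) -mulrDl.
by rewrite [X in (X + _)]excess_gt0// subrK mulrAC divff// mul1r.
Qed.

Lemma relative_excess_mul k mu z : 0 <= mu ->
  z * relative_excess k mu z = excess mu z ^+ k.+1.
Proof.
move=> mu0; have [z0|z0] := eqVneq z 0.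
  by rewrite z0 mul0r excess_eq0// expr0n.
by rewrite /relative_excess mulrC divfK.
Qed.

(** For D = z - mu > 0 the two sides differ by (a D - z)^2 D^k / (a z).  This
    trades the weight 1 / z of the decoupled moment for a factor z = D + mu. *)
Lemma excess_am_gm k mu z a : 0 <= mu -> 0 < a ->
  2 * excess mu z ^+ k.+1 <= a * relative_excess k.+1 mu z +
    a^-1 * (excess mu z ^+ k.+1 + mu * excess mu z ^+ k).
Proof.
move=> mu0 a0; have [zmu|muz] := leP z mu.
  rewrite {1}excess_eq0// expr0n mulr0 addr_ge0// mulr_ge0 ?(ltW a0)//.
  - exact: relative_excess_ge0.
  - by rewrite invr_ge0 ltW.
  - by rewrite addr_ge0 ?mulr_ge0 ?exprn_ge0 ?excess_ge0.
have z0 : 0 < z by rewrite (le_lt_trans mu0).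
rewrite /relative_excess !exprS -(mulrDl _ mu) [X in (X + mu)]excess_gt0// subrK.
have Dk0 := exprn_ge0 k (excess_ge0 mu z).
set D := excess mu z in Dk0 *; set Dk := D ^+ k in Dk0 *.
have -> : a * (D * (D * Dk) / z) + a^-1 * (z * Dk) =
    (a * D ^+ 2 / z + z / a) * Dk by field; rewrite !gt_eqF.
rewrite mulrA ler_wpM2r//.
have -> : a * D ^+ 2 / z + z / a = 2 * D + (a * D - z) ^+ 2 / (a * z).
  by field; rewrite !gt_eqF.
by rewrite lerDl divr_ge0 ?sqr_ge0// mulr_ge0// ltW.
Qed.

(** Because exp(-y) <= 1 / (1 + y) and (1 + y)(1 - y + y^2) = 1 + y^3. *)
Lemma expRN_le y : 0 <= y -> expR (- y) <= 1 - y + y ^+ 2.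
Proof.
move=> y0; rewrite expRN.
apply: (@le_trans _ _ (1 + y)^-1).
  rewrite lef_pV2 ?posrE ?expR_gt0 ?expR_ge1Dx//.
  by rewrite (lt_le_trans ltr01)// lerDl.
have y1 : 0 < 1 + y by rewrite (lt_le_trans ltr01)// lerDl.
by rewrite -div1r ler_pdivrMr//; have := mulr_ge0 y0 (sqr_ge0 y); rewrite expr2; nra.
Qed.

(** The (k+1)-st power of t <= exp(t - 1) at t = l y / (k+1). *)
Lemma pow_le_expR k l y : 0 < l ->
  excess 0 y ^+ k.+1 <= (k.+1%:R / l * expR (-1)) ^+ k.+1 * expR (l * y).
Proof.
move=> l0; have [y0|y0] := leP y 0.
  by rewrite excess_eq0// expr0n mulr_ge0 ?expR_ge0// exprn_ge0// mulr_ge0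
    ?expR_ge0// divr_ge0// ltW.
rewrite excess_gt0// subr0.
have -> : expR (l * y) = expR (l * y / k.+1%:R) ^+ k.+1.
  by rewrite -expRM_natl [X in _ = expR X]mulrC divfK// pnatr_eq0.
rewrite -exprMn lerXn2r ?nnegrE//; first exact: ltW.
  by rewrite !mulr_ge0 ?expR_ge0 ?invr_ge0// ltW.
rewrite -(mulrA (_ / _)) -expRD.
have := expR_ge1Dx (-1 + l * y / k.+1%:R); rewrite addrA subrr add0r => h.
have c0 : 0 < k.+1%:R / l by rewrite divr_gt0.
apply: le_trans (ler_wpM2l (ltW c0) h).
by rewrite le_eqVlt; apply/orP; left; apply/eqP; field; rewrite nat1r !gt_eqF.
Qed.

Lemma measurable_excess mu : measurable_fun setT (excess mu).
Proof.
apply: measurable_maxr => //; exact: measurable_funB.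
Qed.

Lemma measurable_relative_excess k mu : 0 <= mu ->
  measurable_fun setT (relative_excess k mu).
Proof.
move=> mu0; apply: nondecreasing_measurable => //.
exact: relative_excess_homo.
Qed.

End real_inequalities.

Section sqrt_e.
Variable R : realType.

Lemma sqrt_expR1 : Num.sqrt (expR 1) = expR 2^-1 :> R.
Proof.
have -> : expR 1 = expR 2^-1 ^+ 2 :> R by rewrite -expRM_natr mulVf.
by rewrite sqrtr_sqr ger0_norm ?expR_ge0.
Qed.

Lemma sqrt_expR1_gt1 : 1 < Num.sqrt (expR 1) :> R.
Proof. by rewrite sqrt_expR1 expR_gt1. Qed.

Lemma sqrt_expR1_le2 : Num.sqrt (expR 1) <= 2 :> R.
Proof.
rewrite sqrt_expR1 -[leRHS]invrK -[leLHS]invrK lef_pV2 ?posrE ?invr_gt0 ?expR_gt0//.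
by rewrite -expRN; have := expR_ge1Dx (- 2^-1 : R); lra.
Qed.

(** With r = sqrt e > 1, kappa = r / (2 (r - 1)) >= 1 exactly when r <= 2. *)
Lemma kappa_ge1 : 1 <= kappa R.
Proof.
have r1 := sqrt_expR1_gt1; have r2 := sqrt_expR1_le2.
rewrite /kappa ler_pdivlMr; lra.
Qed.

(** With r = sqrt e, the claim 2 / r^2 <= 1 / (r^2 - r) again says r <= 2. *)
Lemma bigK_ge : 2 / expR 1 <= bigK R.
Proof.
have r1 := sqrt_expR1_gt1; have r2 := sqrt_expR1_le2.
have e2 : expR 1 = Num.sqrt (expR 1) ^+ 2 :> R by rewrite sqr_sqrtr// expR_ge0.
rewrite /bigK e2 sqrtr_sqr ger0_norm; last by lra.
set r := Num.sqrt _ in r1 r2 *.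
rewrite ler_pdivrMr; last by nra.
rewrite mulrC ler_pdivlMr; last by nra.
nra.
Qed.

End sqrt_e.

(** * Independence and partial sums *)

Section independence.
Context (d : measure_display) (T : measurableType d) (R : realType).
Variable P : probability T R.

Definition independent_pair (U V : T -> R) : Prop :=
  forall A B : set R, measurable A -> measurable B ->
  P (U @^-1` A `&` V @^-1` B) = (P (U @^-1` A) * P (V @^-1` B))%E.

(** Mutual independence of plain functions: stated without the structure of
    random variable, it passes to compositions such as positive parts. *)
Definition independent_family (I : finType) (X : I -> T -> R) : Prop :=
  forall (J : {set I}) (A : I -> set R),
    (forall i, i \in J -> measurable (A i)) ->
    P [set w | forall i, i \in J -> A i (X i w)] =
    (\prod_(i in J) P (X i @^-1` A i))%E.

Lemma measurable_preimageT (U : T -> R) (A : set R) :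
  measurable_fun setT U -> measurable A -> measurable (U @^-1` A).
Proof. by move=> mU mA; rewrite -[X in measurable X]setTI; exact: mU. Qed.

Lemma independent_family_comp (I : finType) (X : I -> T -> R) (f : R -> R) :
  measurable_fun setT f -> independent_family X ->
  independent_family (fun i => f \o X i).
Proof.
move=> mf indX J A mA; rewrite -(indX J (fun i => f @^-1` A i)) //.
by move=> i /mA mAi; rewrite -[X in measurable X]setTI; exact: mf.
Qed.

Lemma independent_pair_comp (U V : T -> R) (f g : R -> R) :
  measurable_fun setT f -> measurable_fun setT g -> independent_pair U V ->
  independent_pair (f \o U) (g \o V).
Proof.
by move=> mf mg indUV A B mA mB; apply: (indUV (f @^-1` A) (g @^-1` B));
  rewrite -[X in measurable X]setTI; [exact: mf|exact: mg].
Qed.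

(** An event that is independent of the rectangle events of (U, V) is independent
    of every event of (U, V): both sides are finite measures in C that agree on
    the rectangles, a pi-system generating the product sigma-algebra. *)
Lemma independent_of_pair (E : set T) (U V : T -> R) :
    measurable E -> measurable_fun setT U -> measurable_fun setT V ->
    (forall A B : set R, measurable A -> measurable B ->
      P (E `&` (U @^-1` A `&` V @^-1` B)) =
      (P E * P (U @^-1` A `&` V @^-1` B))%E) ->
  forall C : set (R * R), measurable C ->
    P (E `&` (fun w => (U w, V w)) @^-1` C) =
    (P E * P ((fun w => (U w, V w)) @^-1` C))%E.
Proof.
move=> mE mU mV EUV C mC.
have PEfin : P E \is a fin_num by exact: fin_num_measure.
pose p : {nonneg R} := NngNum (fine_ge0 (measure_ge0 P E)).
have pE : (p%:num%:E = P E)%E by rewrite /p /= fineK.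
have mUV : measurable_fun setT (fun w => (U w, V w)).
  exact: measurable_fun_pair.
pose UVmixin := isMeasurableFun.Build _ _ _ _ _ mUV.
pose UV : {mfun T >-> (R * R)%type} := HB.pack (fun w => (U w, V w)) UVmixin.
pose m1 : {measure set (R * R) -> \bar R} := pushforward (mrestr P mE) UV.
pose m2 : {measure set (R * R) -> \bar R} := mscale p (pushforward P UV).
have m1E A : m1 mUV A = P (E `&` UV @^-1` A).
  by rewrite /m1 /= /pushforward /mrestr setIC.
have m2E A : m2 mUV A = (P E * P (UV @^-1` A))%E.
  by rewrite /m2 /= /mscale pE.
rewrite -[LHS]m1E -[RHS]m2E.
pose G : set (set (R * R)) := [set A `*` B | A in measurable & B in measurable].
apply: (measure_unique G (fun=> setT)) => //.
- by rewrite measurable_prod_measurableType.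
- move=> _ _ [A1 mA1 [A2 mA2 <-]] [B1 mB1 [B2 mB2 <-]].
  exists (A1 `&` B1); first exact: measurableI.
  by exists (A2 `&` B2); [exact: measurableI|rewrite setXI].
- by move=> _; exists setT => //; exists setT => //; rewrite setXTT.
- by rewrite bigcup_const//; exists 0%N.
- by move=> _ [A mA [B mB <-]]; rewrite m1E m2E; exact: EUV.
- by move=> _; rewrite m1E preimage_setT setIT ltey_eq PEfin.
Qed.

(** The induction on the list s needs the extra events X_i in A_i (i in J):
    to append j to s, the joint law of X_j and the sum over s is first handled on
    rectangles, where the condition X_j in A' is absorbed into the family J. *)
Lemma independent_partial_sum (I : finType) (X : I -> T -> R) :
    (forall i, measurable_fun setT (X i)) -> independent_family X ->
  forall (s : seq I), uniq s ->
  forall (J : {set I}) (A : I -> set R) (B : set R),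
    {in s, forall i, i \notin J} ->
    (forall i, i \in J -> measurable (A i)) -> measurable B ->
  P ([set w | forall i, i \in J -> A i (X i w)] `&`
     [set w | B (\sum_(i <- s) X i w)]) =
  (P [set w | forall i, i \in J -> A i (X i w)] *
   P [set w | B (\sum_(i <- s) X i w)%R])%E.
Proof.
move=> mX indX; elim => [_|j s IH /= /andP[js us]] J A B sJ mA mB.
  have [B0|B0] := pselect (B 0).
    rewrite [X in _ `&` X](_ : _ = setT); last first.
      by apply/seteqP; split => // w _ /=; rewrite big_nil.
    rewrite [X in (_ * P X)%E](_ : _ = setT); last first.
      by apply/seteqP; split => // w _ /=; rewrite big_nil.
    by rewrite setIT probability_setT mule1.
  rewrite [X in _ `&` X](_ : _ = set0); last first.
    by apply/seteqP; split => // w /=; rewrite big_nil.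
  rewrite [X in (_ * P X)%E](_ : _ = set0); last first.
    by apply/seteqP; split => // w /=; rewrite big_nil.
  by rewrite setI0 measure0 mule0.
have jJ : j \notin J by apply: sJ; rewrite mem_head.
have sJ' : {in s, forall i, i \notin J}.
  by move=> i si; apply: sJ; rewrite in_cons si orbT.
pose S w := \sum_(i <- s) X i w.
have mS : measurable_fun setT S by exact: measurable_sum.
set E := [set w | forall i, i \in J -> A i (X i w)].
have mE : measurable E.
  rewrite (_ : E = \bigcap_(i in [set` J]) (X i @^-1` A i)); last first.
    by apply/seteqP; split => w Ew i; exact: Ew.
  apply: fin_bigcap_measurable => // i iJ.
  by apply: measurable_preimageT => //; exact: mA.
(* F A' extends the events A of the family J by the condition A' on X_j. *)
pose F (A' : set R) i := if i == j then A' else A i.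
have mF A' (J' : {set I}) : measurable A' -> J' \subset J ->
    forall i, i \in j |: J' -> measurable (F A' i).
  move=> mA' /fintype.subsetP J'J i; rewrite !inE /F.
  by case: eqP => //= _ iJ'; exact: (mA _ (J'J _ iJ')).
have FJ A' i : i \in J -> F A' i = A i.
  by move=> iJ; rewrite /F; case: eqP iJ => // ->; rewrite (negbTE jJ).
have EvU A' (J' : {set I}) : J' \subset J ->
    [set w | forall i, i \in j |: J' -> F A' i (X i w)] =
    X j @^-1` A' `&` [set w | forall i, i \in J' -> A i (X i w)].
  move=> /fintype.subsetP J'J; apply/seteqP; split => w /=.
    move=> Fw; split; first by have := Fw j; rewrite setU11 /F eqxx; apply.
    by move=> i iJ'; rewrite -(FJ A') ?J'J//; apply: Fw; rewrite inE iJ' orbT.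
  move=> [A'w Aw] i; rewrite !inE; case: eqVneq => [->|ij] /=.
    by rewrite /F eqxx.
  by move=> iJ'; rewrite FJ ?J'J//; exact: Aw.
have step A' B' (J' : {set I}) : measurable A' -> measurable B' ->
    J' \subset J ->
    P ([set w | forall i, i \in J' -> A i (X i w)] `&`
       (X j @^-1` A' `&` S @^-1` B')) =
    (P [set w | forall i, i \in J' -> A i (X i w)] *
     (P (X j @^-1` A') * P (S @^-1` B')))%E.
  move=> mA' mB' J'J; rewrite setIA (setIC _ (X j @^-1` A')) -EvU//.
  rewrite IH//; last 2 first.
  - move=> i si; rewrite !inE negb_or; apply/andP; split.
      by apply: contraNneq js => <-.
    by apply: contra (sJ' _ si); exact: (fintype.subsetP J'J).
  - by move=> i; exact: mF.
  rewrite indX; last by move=> i; exact: mF.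
  have jJ' : j \notin J' by apply: contra jJ; exact: (fintype.subsetP J'J).
  rewrite big_setU1//= {1}/F eqxx -indX; last first.
    by move=> i iJ'; apply: (mF _ _ mA' J'J); rewrite inE iJ' orbT.
  rewrite (_ : [set w | _] = [set w | forall i, i \in J' -> A i (X i w)]).
    by rewrite muleA (muleC (P _)).
  by apply/seteqP; split => w /= Fw i iJ'; have := Fw _ iJ';
    rewrite FJ// (fintype.subsetP J'J).
have pairS A' B' : measurable A' -> measurable B' ->
    P (X j @^-1` A' `&` S @^-1` B') = (P (X j @^-1` A') * P (S @^-1` B'))%E.
  move=> mA' mB'; have := step _ _ finset.set0 mA' mB' (finset.sub0set _).
  rewrite (_ : [set w | _] = setT).
    by rewrite setTI probability_setT mul1e.
  by apply/seteqP; split => // w _ i; rewrite inE.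
have := @independent_of_pair E (X j) S mE (mX j) mS.
move=> /(_ _ ((fun z : R * R => z.1 + z.2) @^-1` B)).
rewrite (_ : [set w | B _] = (fun w => (X j w, S w)) @^-1`
    ((fun z : R * R => z.1 + z.2) @^-1` B)).
  apply.
    by move=> A' B' mA' mB'; rewrite step// pairS.
  rewrite -[X in measurable X]setTI.
  by apply: measurable_funD => //; exact: measurable_fst.
by apply/seteqP; split => w /=; rewrite big_cons.
Qed.

Lemma independent_pair_sum (I : finType) (X : I -> T -> R) (s : seq I) (i : I) :
    (forall i, measurable_fun setT (X i)) -> independent_family X ->
    uniq s -> i \notin s ->
  independent_pair (X i) (fun w => \sum_(j <- s) X j w).
Proof.
move=> mX indX us si A B mA mB.
have XA : X i @^-1` A =
    [set w | forall j, j \in [set i]%SET -> A (X j w)].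
  apply/seteqP; split => w /= Aw; first by move=> j; rewrite inE => /eqP ->.
  by apply: Aw; rewrite inE.
rewrite XA; apply: (independent_partial_sum mX indX us (A := fun=> A)) => //.
by move=> j sj; rewrite inE; apply: contraNneq si => <-.
Qed.

Lemma expectation_mul_indep (U V : T -> R) :
  measurable_fun setT U -> measurable_fun setT V ->
  (forall w, 0 <= U w) -> (forall w, 0 <= V w) -> independent_pair U V ->
  (\int[P]_w (U w * V w)%:E = (\int[P]_w (U w)%:E) * (\int[P]_w (V w)%:E))%E.
Proof.
move=> mU mV U0 V0 indUV.
pose UM : {mfun T >-> R} := HB.pack U (isMeasurableFun.Build _ _ _ _ _ mU).
pose VM : {mfun T >-> R} := HB.pack V (isMeasurableFun.Build _ _ _ _ _ mV).
have mUV : measurable_fun setT (fun w => (U w, V w)).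
  exact: measurable_fun_pair.
pose UV : {mfun T >-> (R * R)%type} :=
  HB.pack (fun w => (U w, V w)) (isMeasurableFun.Build _ _ _ _ _ mUV).
pose f (z : R * R) : \bar R := (`|z.1| * `|z.2|)%:E.
have mf : measurable_fun [set: R * R] f.
  apply/measurable_EFinP; apply: measurable_funM.
    exact: measurableT_comp measurable_fst.
  exact: measurableT_comp measurable_snd.
have f0 z : (0 <= f z)%E by rewrite lee_fin mulr_ge0.
transitivity (\int[distribution P UV]_z f z)%E.
  rewrite ge0_integral_distribution//; apply: eq_integral => w _.
  by rewrite /f /= !ger0_norm.
transitivity (\int[distribution P UM \x distribution P VM]_z f z)%E.
  apply: eq_measure_integral => A mA _; apply/esym.
  exact: product_measure_unique.
rewrite fubini_tonelli1// /fubini_F.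
transitivity (\int[distribution P UM]_x (`|x|%:E *
   \int[distribution P VM]_y `|y|%:E))%E.
  apply: eq_integral => x _; rewrite /f /=.
  under eq_integral do rewrite EFinM.
  by rewrite ge0_integralZl//; exact/measurable_EFinP.
rewrite ge0_integralZr//.
- rewrite !ge0_integral_distribution//; try by apply/measurable_EFinP.
  by congr (_ * _)%E; apply: eq_integral => w _ /=; rewrite ger0_norm.
- exact/measurable_EFinP.
- by apply: integral_ge0 => y _; rewrite lee_fin.
Qed.

End independence.

(** * Decoupling *)

Section decoupling.
Context (d : measure_display) (T : measurableType d) (R : realType).
Variables (P : probability T R) (I : finType) (X : I -> T -> R).
Hypothesis mX : forall i, measurable_fun setT (X i).
Hypothesis X0 : forall i w, 0 <= X i w.
Hypothesis indX : independent_family P X.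

Let Z w := \sum_i X i w.

(** In the splitting of Z phi(Z), the terms X_i phi(Z - X_i) are products of
    independent factors, and monotonicity gives E phi(Z - X_i) <= E phi(Z). *)
Lemma decoupling_inequality (phi : R -> R) :
    measurable_fun setT phi -> (forall x, 0 <= phi x) ->
    {homo phi : x y / x <= y} ->
  (\int[P]_w (Z w * phi (Z w))%:E <=
   (\int[P]_w (Z w)%:E) * (\int[P]_w (phi (Z w))%:E) +
   \int[P]_w (\sum_i X i w * (phi (Z w) - phi (Z w - X i w)))%:E)%E.
Proof.
move=> mphi phi0 ndphi.
have mZ : measurable_fun setT Z by exact: measurable_sum.
have mrest i : measurable_fun setT (fun w => phi (Z w - X i w)).
  by apply: measurableT_comp => //; exact: measurable_funB.
have mphiZ : measurable_fun setT (fun w => phi (Z w)).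
  exact: measurableT_comp.
have ndi i w : phi (Z w - X i w) <= phi (Z w).
  by apply: ndphi; rewrite lerBlDr lerDl.
have split_Z w : (Z w * phi (Z w) = \sum_i X i w * phi (Z w - X i w) +
    \sum_i X i w * (phi (Z w) - phi (Z w - X i w)))%R.
  rewrite /Z mulr_suml -big_split /=; apply: eq_bigr => i _.
  by rewrite -mulrDr addrC subrK.
under eq_integral do rewrite split_Z EFinD.
rewrite ge0_integralD//; first last.
- apply/measurable_EFinP; apply: measurable_sum => i.
  by apply: measurable_funM => //; exact: measurable_funB.
- by move=> w _; rewrite lee_fin sumr_ge0// => i _; rewrite mulr_ge0// subr_ge0.
- by apply/measurable_EFinP; apply: measurable_sum => i; exact: measurable_funM.
- by move=> w _; rewrite lee_fin sumr_ge0// => i _; rewrite mulr_ge0.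
apply: leeD => //.
under eq_integral do rewrite -sumEFin.
rewrite ge0_integral_sum//; last 2 first.
- by move=> i; apply/measurable_EFinP; exact: measurable_funM.
- by move=> i w _; rewrite lee_fin mulr_ge0.
under [X in (_ <= X * _)%E]eq_integral do rewrite /Z -sumEFin.
rewrite ge0_integral_sum//; last 2 first.
- by move=> i; exact/measurable_EFinP.
- by move=> i w _; rewrite lee_fin.
rewrite ge0_sume_distrl; last first.
  by move=> i _; apply: integral_ge0 => w _; rewrite lee_fin.
apply: lee_sum => i _.
(* Z - X_i as a sum over a duplicate-free list, so that it is independent of X_i. *)
have restE w : Z w - X i w = \sum_(j <- rem i (index_enum I)) X j w.
  by rewrite /Z (big_rem i) ?mem_index_enum//= addrAC subrr add0r.
have indi : independent_pair P (X i) (fun w => phi (Z w - X i w)).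
  rewrite [X in independent_pair _ _ X](_ : _ =
    phi \o (fun w => \sum_(j <- rem i (index_enum I)) X j w)).
    apply: (@independent_pair_comp _ _ _ _ _ _ idfun phi) => //.
    - exact: measurable_id.
    apply: independent_pair_sum => //; first by rewrite rem_uniq// index_enum_uniq.
    by rewrite mem_rem_uniqF// index_enum_uniq.
  by apply/funext => w /=; rewrite restE.
rewrite (expectation_mul_indep _ _ _ _ indi)//.
apply: lee_pmul => //; first by apply: integral_ge0 => w _; rewrite lee_fin.
  by apply: integral_ge0 => w _; rewrite lee_fin.
apply: ge0_le_integral => //.
- by move=> w _; rewrite lee_fin.
- exact/measurable_EFinP.
- exact/measurable_EFinP.
- by move=> w _; rewrite lee_fin.
Qed.

End decoupling.

(** * Moments above the mean *)

Section deviation.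
Context (d : measure_display) (T : measurableType d) (R : realType).
Variable P : probability T R.

(** A form of Hoelder's inequality, obtained by integrating Young's inequality
    for A / a and D / x. *)
Lemma young_moment (A D : T -> R) (k : nat) (a x : R) :
    measurable_fun setT A -> measurable_fun setT D ->
    (forall w, 0 <= A w) -> (forall w, 0 <= D w) -> 0 < a -> 0 < x ->
    (\int[P]_w (A w ^+ k.+1)%:E <= (a ^+ k.+1)%:E)%E ->
    (\int[P]_w (D w ^+ k.+1)%:E <= (x ^+ k.+1)%:E)%E ->
  (\int[P]_w (A w * D w ^+ k)%:E <= (a * x ^+ k)%:E)%E.
Proof.
move=> mA mD A0 D0 a0 x0 IA ID.
have mAk : measurable_fun setT (fun w => A w ^+ k.+1) by exact: measurable_funX.
have mDk : measurable_fun setT (fun w => D w ^+ k.+1) by exact: measurable_funX.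
(* The weights of A^(k+1) and D^(k+1) in the rescaled Young inequality; at the
   norms a and x they add up to a x^k. *)
set ca := a * x ^+ k / (k.+1%:R * a ^+ k.+1).
set cx := a * x ^+ k * k%:R / (k.+1%:R * x ^+ k.+1).
have xk0 : 0 < x ^+ k by exact: exprn_gt0.
have ca0 : 0 <= ca.
  by rewrite /ca divr_ge0 ?mulr_ge0 ?exprn_ge0// ltW.
have cx0 : 0 <= cx.
  by rewrite /cx divr_ge0 ?mulr_ge0 ?exprn_ge0// ltW.
have pointwise w : A w * D w ^+ k <= ca * A w ^+ k.+1 + cx * D w ^+ k.+1.
  have H := young_pow k (divr_ge0 (A0 w) (ltW a0)) (divr_ge0 (D0 w) (ltW x0)).
  rewrite !expr_div_n in H.
  have c0 : 0 < a * x ^+ k / k.+1%:R by rewrite divr_gt0 ?mulr_gt0.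
  apply: le_trans (le_trans _ (ler_wpM2l (ltW c0) H)) _;
    rewrite le_eqVlt; apply/orP; left; apply/eqP.
    by field; rewrite !gt_eqF.
  rewrite /ca /cx; field.
  by rewrite !gt_eqF// exprn_gt0.
apply: (@le_trans _ _ (\int[P]_w
    ((ca * A w ^+ k.+1)%:E + (cx * D w ^+ k.+1)%:E))%E).
  apply: ge0_le_integral => //.
  - by move=> w _; rewrite lee_fin mulr_ge0// exprn_ge0.
  - by apply/measurable_EFinP; apply: measurable_funM => //; exact: measurable_funX.
  - by apply: emeasurable_funD; apply/measurable_EFinP; exact: measurable_funM.
  - by move=> w _; rewrite -EFinD lee_fin.
rewrite ge0_integralD//; first last.
- by apply/measurable_EFinP; exact: measurable_funM.
- by move=> w _; rewrite lee_fin mulr_ge0// exprn_ge0.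
- by apply/measurable_EFinP; exact: measurable_funM.
- by move=> w _; rewrite lee_fin mulr_ge0// exprn_ge0.
under eq_integral do rewrite EFinM.
under [X in (_ + X <= _)%E]eq_integral do rewrite EFinM.
rewrite !ge0_integralZl//; first last.
- by move=> w _; rewrite lee_fin exprn_ge0.
- exact/measurable_EFinP.
- by move=> w _; rewrite lee_fin exprn_ge0.
- exact/measurable_EFinP.
apply: (@le_trans _ _ (ca%:E * (a ^+ k.+1)%:E + cx%:E * (x ^+ k.+1)%:E)%E).
  by apply: leeD; apply: lee_pmul => //; apply: integral_ge0 => w _;
    rewrite lee_fin exprn_ge0.
rewrite lee_fin le_eqVlt; apply/orP; left; apply/eqP.
rewrite /ca /cx -natr1; field.
by rewrite !gt_eqF// ?exprn_gt0// natr1.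
Qed.

Context (I : finType) (X : I -> T -> R).
Hypothesis mX : forall i, measurable_fun setT (X i).
Hypothesis X0 : forall i w, 0 <= X i w.
Hypothesis indX : independent_family P X.

Let Z w := \sum_i X i w.

(** Decoupling for the relative excess.  The term mu E phi(Z) occurs on both
    sides, and it may be cancelled because it is at most the finite moment of the
    excess. *)
Lemma excess_moment_decoupling (k : nat) (mu : R) (M : T -> R) :
    measurable_fun setT M -> (forall i w, X i w <= M w) ->
    (forall w, 0 <= M w) ->
    (\int[P]_w (Z w)%:E = mu%:E)%E ->
    (\int[P]_w (excess mu (Z w) ^+ k.+1)%:E < +oo)%E ->
  (\int[P]_w (relative_excess k.+1 mu (Z w))%:E <=
   k.+1%:R%:E * \int[P]_w (M w * excess mu (Z w) ^+ k)%:E)%E.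
Proof.
move=> mM XM M0 EZ Dfin.
have mZ : measurable_fun setT Z by exact: measurable_sum.
have Z0 w : 0 <= Z w by exact: sumr_ge0.
have mu0 : 0 <= mu.
  by rewrite -lee_fin -EZ; apply: integral_ge0 => w _; rewrite lee_fin.
have mrel j : measurable_fun setT (fun w => relative_excess j mu (Z w)).
  by apply: measurableT_comp => //; exact: measurable_relative_excess.
have mexc j : measurable_fun setT (fun w => excess mu (Z w) ^+ j).
  by apply: measurable_funX; apply: measurableT_comp => //; exact: measurable_excess.
have rel0 j w : 0 <= relative_excess j mu (Z w) by exact: relative_excess_ge0.
have exc0 j w : 0 <= excess mu (Z w) ^+ j by rewrite exprn_ge0// excess_ge0.
have mrest i : measurable_fun setT
    (fun w => relative_excess k mu (Z w - X i w)).
  have mZX : measurable_fun setT (Z \- X i) by exact: measurable_funB.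
  exact: measurableT_comp (measurable_relative_excess k mu0) mZX.
have splitD : (\int[P]_w (excess mu (Z w) ^+ k.+1)%:E =
    \int[P]_w (relative_excess k.+1 mu (Z w))%:E +
    mu%:E * \int[P]_w (relative_excess k mu (Z w))%:E)%E.
  under eq_integral do rewrite relative_excess_split// EFinD (EFinM mu).
  rewrite ge0_integralD//; first last.
  - by apply: measurable_funeM; exact/measurable_EFinP.
  - by move=> w _; rewrite -EFinM lee_fin mulr_ge0.
  - exact/measurable_EFinP.
  - by move=> w _; rewrite lee_fin.
  by rewrite ge0_integralZl//; [exact/measurable_EFinP|
    move=> w _; rewrite lee_fin].
have W0 : (0 <= \int[P]_w (relative_excess k.+1 mu (Z w))%:E)%E.
  by apply: integral_ge0 => w _; rewrite lee_fin.
have F0 : (0 <= mu%:E * \int[P]_w (relative_excess k mu (Z w))%:E)%E.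
  by rewrite mule_ge0//; apply: integral_ge0 => w _; rewrite lee_fin.
have Ffin : (mu%:E * \int[P]_w (relative_excess k mu (Z w))%:E)%E \is a fin_num.
  by rewrite ge0_fin_numE//; apply: le_lt_trans Dfin; rewrite splitD leeDr.
rewrite -(leeD2lE _ _ Ffin) [leLHS]addeC -splitD.
have := decoupling_inequality mX X0 indX (measurable_relative_excess k mu0)
  (fun z => relative_excess_ge0 k z mu0) (relative_excess_homo k mu0).
rewrite -/Z EZ => H.
under eq_integral do rewrite -relative_excess_mul//.
apply: (le_trans H); apply: leeD => //.
rewrite -ge0_integralZl//; last 2 first.
- by apply/measurable_EFinP; exact: measurable_funM.
- by move=> w _; rewrite lee_fin mulr_ge0.
apply: ge0_le_integral => //.
- move=> w _; rewrite lee_fin sumr_ge0// => i _; rewrite mulr_ge0// subr_ge0.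
  by apply: relative_excess_homo => //; rewrite lerBlDr lerDl.
- apply/measurable_EFinP; apply: measurable_sum => i.
  by apply: measurable_funM => //; exact: (measurable_funB (mrel k) (mrest i)).
- by apply: measurable_funeM; apply/measurable_EFinP; exact: measurable_funM.
move=> w _; rewrite -EFinM lee_fin.
have XZ i : X i w <= Z w by rewrite /Z (bigD1 i)//= lerDl sumr_ge0.
set c := k.+1%:R * excess mu (Z w) ^+ k / Z w.
have c0 : 0 <= c by rewrite /c divr_ge0// mulr_ge0.
apply: (@le_trans _ _ (\sum_i X i w * (M w * c))).
  apply: ler_sum => i _; apply: ler_wpM2l => //.
  apply: le_trans (relative_excess_lip k mu0 _) _; first by rewrite X0 XZ.
  by rewrite ler_wpM2r.
rewrite -mulr_suml -/(Z w) /c.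
have [z0|z0] := eqVneq (Z w) 0.
  by rewrite z0 mul0r !mulr_ge0// exprn_ge0// excess_ge0.
by rewrite le_eqVlt; apply/orP; left; apply/eqP; field.
Qed.

(** Integrates [excess_am_gm].  With a = x / ((k+1) m) the two sides read
    2 x <= x + (k+1) m (x + mu) / x, up to the common factor x^k. *)
Lemma excess_moment_quadratic (k : nat) (mu m x : R) (M : T -> R) :
    measurable_fun setT M -> (forall i w, X i w <= M w) ->
    (forall w, 0 <= M w) ->
    (\int[P]_w (Z w)%:E = mu%:E)%E -> 0 < m -> 0 <= x ->
    (\int[P]_w (M w ^+ k.+1)%:E <= (m ^+ k.+1)%:E)%E ->
    (\int[P]_w (excess mu (Z w) ^+ k.+1)%:E = (x ^+ k.+1)%:E)%E ->
  x ^+ 2 <= k.+1%:R * m * (x + mu).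
Proof.
move=> mM XM M0 EZ m0 x0 IM ID.
have mZ : measurable_fun setT Z by exact: measurable_sum.
have Z0 w : 0 <= Z w by exact: sumr_ge0.
have mu0 : 0 <= mu.
  by rewrite -lee_fin -EZ; apply: integral_ge0 => w _; rewrite lee_fin.
have [->|x_neq0] := eqVneq x 0.
  by rewrite expr0n /= !mulr_ge0// ?add0r// ltW.
have xgt0 : 0 < x by rewrite lt_neqAle eq_sym x_neq0.
have mD : measurable_fun setT (fun w => excess mu (Z w)).
  by apply: measurableT_comp => //; exact: measurable_excess.
have mexc j : measurable_fun setT (fun w => excess mu (Z w) ^+ j).
  exact: measurable_funX.
have D0 w : 0 <= excess mu (Z w) by exact: excess_ge0.
have exc0 j w : 0 <= excess mu (Z w) ^+ j by rewrite exprn_ge0.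
have rel0 j w : 0 <= relative_excess j mu (Z w) by exact: relative_excess_ge0.
have mrel j : measurable_fun setT (fun w => relative_excess j mu (Z w)).
  by apply: measurableT_comp => //; exact: measurable_relative_excess.
have IMD := young_moment mM mD M0 D0 m0 xgt0 IM (eq_ind_r (fun y => y <= _)%E (lexx _) ID).
have ID' : (\int[P]_w (excess mu (Z w) ^+ k)%:E <= (x ^+ k)%:E)%E.
  have := @young_moment (cst 1) _ k 1 x (measurable_cst _) mD (fun=> ler01)
    D0 ltr01 xgt0.
  rewrite mul1r; under [X in (_ -> _ -> X <= _)%E]eq_integral do rewrite mul1r.
  apply; last by rewrite ID.
  under eq_integral do rewrite /cst expr1n.
  by rewrite integral_cst// mul1e expr1n probability_le1.
have Wle : (\int[P]_w (relative_excess k.+1 mu (Z w))%:E <=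
    (k.+1%:R * (m * x ^+ k))%:E)%E.
  apply: le_trans (excess_moment_decoupling mM XM M0 EZ _) _.
    by rewrite ID ltry.
  by rewrite (EFinM k.+1%:R) lee_pmul2l// lte_fin.
set a := x / (k.+1%:R * m).
have a0 : 0 < a by rewrite divr_gt0// mulr_gt0.
have main : ((2 * x ^+ k.+1)%:E <= (a * (k.+1%:R * (m * x ^+ k)) +
    a^-1 * (x ^+ k.+1 + mu * x ^+ k))%:E)%E.
  rewrite EFinM -ID -ge0_integralZl//; last 2 first.
  - exact/measurable_EFinP.
  - by move=> w _; rewrite lee_fin.
  apply: (@le_trans _ _ (\int[P]_w (a%:E * (relative_excess k.+1 mu (Z w))%:E +
     a^-1%:E * ((excess mu (Z w) ^+ k.+1)%:E +
                mu%:E * (excess mu (Z w) ^+ k)%:E)))%E).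
    apply: ge0_le_integral => //.
    - by move=> w _; rewrite -EFinM lee_fin mulr_ge0.
    - by apply: measurable_funeM; exact/measurable_EFinP.
    - apply: emeasurable_funD.
        by apply: measurable_funeM; exact/measurable_EFinP.
      apply: measurable_funeM; apply: emeasurable_funD.
        exact/measurable_EFinP.
      by apply: measurable_funeM; exact/measurable_EFinP.
    - by move=> w _; rewrite -!EFinM -!EFinD lee_fin excess_am_gm.
  rewrite ge0_integralD//; first last.
  - apply: measurable_funeM; apply: emeasurable_funD.
      exact/measurable_EFinP.
    by apply: measurable_funeM; exact/measurable_EFinP.
  - move=> w _; rewrite -!EFinM lee_fin mulr_ge0 ?invr_ge0 ?(ltW a0)//.
    by rewrite addr_ge0// mulr_ge0.
  - by apply: measurable_funeM; exact/measurable_EFinP.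
  - by move=> w _; rewrite -EFinM lee_fin mulr_ge0// ltW.
  rewrite ge0_integralZl//; first last.
  - by rewrite lee_fin ltW.
  - by move=> w _; rewrite lee_fin.
  - exact/measurable_EFinP.
  rewrite ge0_integralZl//; first last.
  - by rewrite lee_fin invr_ge0 ltW.
  - by move=> w _; rewrite lee_fin addr_ge0// mulr_ge0.
  - apply: emeasurable_funD; first exact/measurable_EFinP.
    by apply: measurable_funeM; exact/measurable_EFinP.
  rewrite ge0_integralD//; first last.
  - by apply: measurable_funeM; exact/measurable_EFinP.
  - by move=> w _; rewrite -EFinM lee_fin mulr_ge0.
  - exact/measurable_EFinP.
  - by move=> w _; rewrite lee_fin.
  rewrite ge0_integralZl//; first last.
  - by move=> w _; rewrite lee_fin.
  - exact/measurable_EFinP.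
  rewrite ID EFinD; apply: leeD; first by rewrite (EFinM a) lee_pmul2l ?lte_fin.
  rewrite (EFinM a^-1) lee_pmul2l ?lte_fin ?invr_gt0//.
  by rewrite EFinD leeD2l// (EFinM mu) lee_wpmul2l// lee_fin.
move: main; rewrite lee_fin exprS.
have xk0 : 0 < x ^+ k by exact: exprn_gt0.
have -> : a * (k.+1%:R * (m * x ^+ k)) = x * x ^+ k.
  by rewrite /a; field; rewrite !gt_eqF.
have -> : a^-1 * (x * x ^+ k + mu * x ^+ k) =
    k.+1%:R * m * (x + mu) / x * x ^+ k.
  by rewrite /a; field; rewrite !gt_eqF.
rewrite mulrA -mulrDl ler_pM2r// -lerBlDl.
have -> : 2 * x - x = x by ring.
by rewrite ler_pdivlMr// expr2.
Qed.

End deviation.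

(** * Moments below the mean *)

Section lower_tail.
Context (d : measure_display) (T : measurableType d) (R : realType).
Variable P : probability T R.

(** Integrates exp(-l Y) + l Y <= 1 + l^2 Y^2 and uses 1 + t <= exp t. *)
Lemma laplace_le (Y : T -> R) (l e s : R) :
    measurable_fun setT Y -> (forall w, 0 <= Y w) -> 0 <= l ->
    (\int[P]_w (Y w)%:E = e%:E)%E ->
    (\int[P]_w (Y w ^+ 2)%:E = s%:E)%E ->
  (\int[P]_w (expR (- (l * Y w)))%:E <= (expR (- (l * e) + l ^+ 2 * s))%:E)%E.
Proof.
move=> mY Y0 l0 IY IY2.
have mexp : measurable_fun setT (fun w => expR (- (l * Y w))).
  apply: measurableT_comp => //; apply: measurableT_comp => //.
  exact: measurable_funM.
have key : (\int[P]_w (expR (- (l * Y w)))%:E + (l * e)%:E <=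
    (1 + l ^+ 2 * s)%:E)%E.
  rewrite EFinM -IY -ge0_integralZl//; first last.
  - by move=> w _; rewrite lee_fin.
  - exact/measurable_EFinP.
  rewrite -ge0_integralD//; first last.
  - by apply: measurable_funeM; exact/measurable_EFinP.
  - by move=> w _; rewrite -EFinM lee_fin mulr_ge0.
  - exact/measurable_EFinP.
  have -> : ((1 + l ^+ 2 * s)%:E =
      \int[P]_w (1%:E + (l ^+ 2)%:E * (Y w ^+ 2)%:E))%E.
    rewrite ge0_integralD//; first last.
    - apply: measurable_funeM; apply/measurable_EFinP.
      exact: measurable_funX.
    - by move=> w _; rewrite -EFinM lee_fin mulr_ge0 ?sqr_ge0.
    rewrite ge0_integralZl//; first last.
    - by rewrite lee_fin sqr_ge0.
    - by move=> w _; rewrite lee_fin sqr_ge0.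
    - by apply/measurable_EFinP; exact: measurable_funX.
    by rewrite IY2 integral_cst//= [X in (_ * X + _)%E]probability_setT mule1.
  apply: ge0_le_integral => //.
  - by move=> w _; rewrite -EFinM -EFinD lee_fin addr_ge0 ?expR_ge0// mulr_ge0.
  - apply: emeasurable_funD; first exact/measurable_EFinP.
    by apply: measurable_funeM; exact/measurable_EFinP.
  - apply: emeasurable_funD => //; apply: measurable_funeM.
    by apply/measurable_EFinP; exact: measurable_funX.
  - move=> w _; rewrite -!EFinM -!EFinD lee_fin -lerBrDr.
    have := expRN_le (mulr_ge0 l0 (Y0 w)); rewrite exprMn; lra.
rewrite -leeBrDr// -EFinB in key.
apply: (le_trans key); rewrite lee_fin.
by have := expR_ge1Dx (- (l * e) + l ^+ 2 * s); lra.
Qed.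

Context (I : finType) (X : I -> T -> R).
Hypothesis mX : forall i, measurable_fun setT (X i).
Hypothesis X0 : forall i w, 0 <= X i w.
Hypothesis indX : independent_family P X.
Variables (e s : I -> R).
Hypothesis EX : forall i, (\int[P]_w (X i w)%:E = (e i)%:E)%E.
Hypothesis EX2 : forall i, (\int[P]_w (X i w ^+ 2)%:E = (s i)%:E)%E.

Lemma laplace_sum_le (l : R) (r : seq I) : 0 <= l -> uniq r ->
  (\int[P]_w (expR (- (l * \sum_(i <- r) X i w)))%:E <=
   (expR (- (l * \sum_(i <- r) e i) + l ^+ 2 * \sum_(i <- r) s i))%:E)%E.
Proof.
move=> l0; elim: r => [_|j r IH /= /andP[jr ur]].
  under eq_integral do rewrite big_nil mulr0 oppr0 expR0.
  by rewrite !big_nil !mulr0 oppr0 addr0 expR0 integral_cst//= mul1e probability_setT.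
pose f (y : R) := expR (- (l * y)).
have mf : measurable_fun setT f.
  by apply: measurableT_comp => //; exact: measurableT_comp.
have mS : measurable_fun setT (fun w => \sum_(i <- r) X i w).
  exact: measurable_sum.
under eq_integral do rewrite big_cons mulrDr opprD expRD.
rewrite (@expectation_mul_indep _ _ _ P (f \o X j)
    (f \o (fun w => \sum_(i <- r) X i w))); first last.
- apply: independent_pair_comp => //; exact: independent_pair_sum.
- by move=> w; rewrite expR_ge0.
- by move=> w; rewrite expR_ge0.
- exact: measurableT_comp.
- exact: measurableT_comp.
rewrite !big_cons !mulrDr opprD addrACA expRD EFinM lee_pmul//.
- by apply: integral_ge0 => w _; rewrite lee_fin expR_ge0.
- by apply: integral_ge0 => w _; rewrite lee_fin expR_ge0.
- exact: laplace_le.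
- exact: IH.
Qed.

Let Z w := \sum_i X i w.

(** Chernoff's method for moments: the exponential bound of a power, integrated,
    with l^2 = (k+1) / (2 v), the minimizer of l^-(k+1) exp(l^2 v). *)
Lemma lower_moment_le (k : nat) (v : R) : 0 < v -> \sum_i s i <= v ->
  (\int[P]_w (excess 0 (\sum_i e i - Z w) ^+ k.+1)%:E <=
   (Num.sqrt (bigK R * k.+1%:R * v) ^+ k.+1)%:E)%E.
Proof.
move=> v0 sv.
have mZ : measurable_fun setT Z by exact: measurable_sum.
set q : R := k.+1%:R; have q0 : 0 < q by rewrite ltr0n.
set l := Num.sqrt (q / (2 * v)).
have l0 : 0 < l by rewrite sqrtr_gt0 divr_gt0// mulr_gt0.
have l2 : l ^+ 2 = q / (2 * v) by rewrite sqr_sqrtr// divr_ge0 ?mulr_ge0// ltW.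
set mu := \sum_i e i.
set c := (q / l * expR (-1)) ^+ k.+1.
have c0 : 0 <= c.
  by rewrite exprn_ge0// mulr_ge0 ?expR_ge0// divr_ge0// ltW.
have mexp : measurable_fun setT (fun w => expR (- (l * Z w))).
  apply: measurableT_comp => //; apply: measurableT_comp => //.
  exact: measurable_funM.
apply: (@le_trans _ _ (\int[P]_w ((c * expR (l * mu))%:E *
    (expR (- (l * Z w)))%:E))%E).
  apply: ge0_le_integral => //.
  - by move=> w _; rewrite lee_fin exprn_ge0// excess_ge0.
  - apply/measurable_EFinP; apply: measurable_funX.
    apply: measurableT_comp; first exact: measurable_excess.
    exact: measurable_funB.
  - by apply: measurable_funeM; exact/measurable_EFinP.
  - move=> w _; rewrite -EFinM lee_fin -mulrA -expRD -mulrBr.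
    exact: pow_le_expR.
rewrite ge0_integralZl//; first last.
- by rewrite lee_fin mulr_ge0// expR_ge0.
- exact/measurable_EFinP.
apply: (@le_trans _ _ ((c * expR (l * mu))%:E *
    (expR (- (l * mu) + l ^+ 2 * v))%:E)%E).
  apply: lee_wpmul2l; first by rewrite lee_fin mulr_ge0// expR_ge0.
  apply: (le_trans (laplace_sum_le (ltW l0) (index_enum_uniq I))).
  by rewrite lee_fin ler_expR lerD2l ler_wpM2l// sqr_ge0.
rewrite -EFinM lee_fin -(mulrA c) -expRD addNKr l2.
have -> : q / (2 * v) * v = k.+1%:R * 2^-1.
  by rewrite -/q; field; rewrite gt_eqF.
rewrite expRM_natl /c -exprMn -(mulrA (q / l)) -expRD.
rewrite lerXn2r ?nnegrE ?sqrtr_ge0//.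
  by rewrite mulr_ge0 ?expR_ge0// divr_ge0// ltW.
rewrite -[leLHS]ger0_norm; last first.
  by rewrite mulr_ge0 ?expR_ge0// divr_ge0// ltW.
rewrite -sqrtr_sqr ler_wsqrtr// !exprMn exprVn l2 -expRM_natl.
have -> : 2%:R * (-1 + 2^-1) = -1 :> R by lra.
rewrite expRN.
have -> : q ^+ 2 * (q / (2 * v))^-1 * (expR 1)^-1 = 2 / expR 1 * q * v.
  by field; rewrite !gt_eqF ?expR_gt0.
by rewrite ler_wpM2r ?(ltW v0)// ler_wpM2r ?(ltW q0)// bigK_ge.
Qed.

End lower_tail.

(** * Norms *)

Section qnorm_lemmas.
Context (d : measure_display) (T : measurableType d) (R : realType).
Variable P : probability T R.
Implicit Types Y : T -> R.

Lemma qnormE k Y : (forall w, 0 <= Y w) ->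
  qnorm P k.+1 Y =
  poweR (\int[P]_w (Y w ^+ k.+1)%:E)%E (k.+1%:R^-1 : R).
Proof.
move=> Y0; rewrite /qnorm unlock; congr poweR; apply: eq_integral => w _ /=.
by rewrite ger0_norm// powR_mulrn.
Qed.

Lemma qnorm_ge0 q Y : (0 <= qnorm P q Y)%E.
Proof. exact: Lnorm_ge0. Qed.

Lemma root_pow k (a : R) : 0 <= a ->
  poweR (a ^+ k.+1)%:E (k.+1%:R^-1 : R) = a%:E.
Proof.
by move=> a0; rewrite poweR_EFin -powR_mulrn// -powRrM mulfV ?powRr1// pnatr_eq0.
Qed.

Lemma qnorm_fin_moment k Y : (forall w, 0 <= Y w) -> (qnorm P k.+1 Y < +oo)%E ->
  exists2 x, 0 <= x & qnorm P k.+1 Y = x%:E /\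
    (\int[P]_w (Y w ^+ k.+1)%:E = (x ^+ k.+1)%:E)%E.
Proof.
move=> Y0 Yfin; have x0 := qnorm_ge0 k.+1 Y.
have /fineK Yx : qnorm P k.+1 Y \is a fin_num by rewrite ge0_fin_numE.
exists (fine (qnorm P k.+1 Y)); first exact: fine_ge0.
split; first exact/esym.
rewrite -powR_mulrn ?fine_ge0// -poweR_EFin Yx qnormE// -poweRrM mulVf ?pnatr_eq0//.
by rewrite poweRe1//; apply: integral_ge0 => w _; rewrite lee_fin exprn_ge0.
Qed.

Lemma qnorm_le k Y a : (forall w, 0 <= Y w) -> 0 <= a ->
  (\int[P]_w (Y w ^+ k.+1)%:E <= (a ^+ k.+1)%:E)%E -> (qnorm P k.+1 Y <= a%:E)%E.
Proof.
move=> Y0 a0 H; rewrite qnormE// -(root_pow k a0).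
have nng (z : \bar R) : (0 <= z)%E -> z \in `[0%E, +oo%E].
  by move=> z0; rewrite in_itv /= z0 leey.
apply: gt0_ler_poweR => //; apply: nng; last by rewrite lee_fin exprn_ge0.
by apply: integral_ge0 => w _; rewrite lee_fin exprn_ge0.
Qed.

Lemma qnorm_ae_eq q Y1 Y2 :
  measurable_fun setT Y1 -> measurable_fun setT Y2 ->
  (\forall w \ae P, Y1 w = Y2 w) -> qnorm P q Y1 = qnorm P q Y2.
Proof.
move=> m1 m2 Y12; rewrite /qnorm unlock; congr poweR.
have mN Y : measurable_fun setT Y ->
    measurable_fun setT (fun w => poweR `|(EFin \o Y) w|%E (q%:R : R)).
  move=> mY; apply: measurableT_comp (measurable_poweR _) _.
  by apply: measurableT_comp => //; exact/measurable_EFinP.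
apply: ae_eq_integral => //; [exact: mN|exact: mN|].
by apply: filterS Y12 => w /= -> _.
Qed.

Lemma qnorm_cst k (a : R) : 0 <= a -> qnorm P k.+1 (cst a) = a%:E.
Proof.
move=> a0; rewrite qnormE//= integral_cst//= probability_setT mule1.
exact: root_pow.
Qed.

End qnorm_lemmas.

Section nonnegative_sums.
Context (d : measure_display) (T : measurableType d) (R : realType).
Variables (P : probability T R) (I : finType) (X : I -> T -> R).
Hypothesis mX : forall i, measurable_fun setT (X i).
Hypothesis X0 : forall i w, 0 <= X i w.
Hypothesis indX : independent_family P X.
Variable e : I -> R.
Hypothesis EX : forall i, (\int[P]_w (X i w)%:E = (e i)%:E)%E.

Let Z w := \sum_i X i w.
Let mu := \sum_i e i.

Let mZ : measurable_fun setT Z. Proof. exact: measurable_sum. Qed.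

Let Z0 w : 0 <= Z w. Proof. exact: sumr_ge0. Qed.

Let EZ : (\int[P]_w (Z w)%:E = mu%:E)%E.
Proof.
under eq_integral do rewrite -sumEFin.
rewrite ge0_integral_sum//.
- by rewrite -sumEFin; apply: eq_bigr.
- by move=> i; exact/measurable_EFinP.
- by move=> i w _; rewrite lee_fin.
Qed.

Let mu0 : 0 <= mu.
Proof.
by rewrite -lee_fin -EZ; apply: integral_ge0 => w _; rewrite lee_fin.
Qed.

(** The excess has a finite norm since Z <= #|I| M.  The quadratic inequality is
    applied with m + del for small del > 0, which covers m = 0. *)
Lemma excess_norm_quadratic (k : nat) (M : T -> R) (m : R) :
    measurable_fun setT M -> (forall i w, X i w <= M w) ->
    (forall w, 0 <= M w) -> qnorm P k.+1 M = m%:E ->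
  exists2 x, 0 <= x & qnorm P k.+1 (fun w => excess mu (Z w)) = x%:E /\
    x ^+ 2 <= k.+1%:R * m * (x + mu).
Proof.
move=> mM XM M0 Mm.
have [m' m'0 [Mm' IM]] := @qnorm_fin_moment _ _ _ P k M M0
  (eq_ind_r (fun y => y < +oo)%E (ltry m) Mm).
have {m' m'0 Mm'}[m0 {}IM] : 0 <= m /\
    (\int[P]_w (M w ^+ k.+1)%:E = (m ^+ k.+1)%:E)%E.
  by move: Mm'; rewrite Mm => -[->].
have ZM w : Z w <= #|I|%:R * M w.
  by rewrite mulr_natl -sumr_const; apply: ler_sum.
have D0 w : 0 <= excess mu (Z w) by exact: excess_ge0.
have mD : measurable_fun setT (fun w => excess mu (Z w)).
  by apply: measurableT_comp => //; exact: measurable_excess.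
have [|x x0 [Dx ID]] := @qnorm_fin_moment _ _ _ P k _ D0.
  apply: (@le_lt_trans _ _ (#|I|%:R * m)%:E); last exact: ltry.
  apply: qnorm_le => //; first by rewrite mulr_ge0.
  rewrite exprMn EFinM -IM -ge0_integralZl//; first last.
  - by move=> w _; rewrite lee_fin exprn_ge0.
  - by apply/measurable_EFinP; exact: measurable_funX.
  apply: ge0_le_integral => //.
  - by move=> w _; rewrite lee_fin exprn_ge0.
  - by apply/measurable_EFinP; exact: measurable_funX.
  - by apply: measurable_funeM; apply/measurable_EFinP; exact: measurable_funX.
  - move=> w _; rewrite -EFinM -exprMn lee_fin lerXn2r ?nnegrE ?mulr_ge0//.
    apply: le_trans (ZM w); rewrite /excess ge_max Z0 andbT.
    by rewrite lerBlDr lerDl.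
exists x => //; split => //.
have x1 : 0 < x + mu + 1 by rewrite ltr_wpDl// addr_ge0.
apply/ler_addgt0Pr => eps eps0.
set del := eps / (k.+1%:R * (x + mu + 1)).
have del0 : 0 < del by rewrite divr_gt0// mulr_gt0.
have := @excess_moment_quadratic _ _ _ P I X mX X0 indX k mu (m + del) x M
  mM XM M0 EZ (ltr_wpDl m0 del0) x0 _ ID.
rewrite IM lee_fin lerXn2r ?nnegrE ?addr_ge0 ?lerDl ?(ltW del0)//.
move=> /(_ isT) /le_trans; apply.
rewrite (mulrDr _ m) mulrDl lerD2l.
have -> : eps = k.+1%:R * del * (x + mu + 1).
  by rewrite /del; field; rewrite nat1r !gt_eqF.
by rewrite ler_wpM2l ?lerDl// mulr_ge0// ltW.
Qed.

(** If x > r + q m with r^2 >= q m mu, then x (x - q m) > r^2 contradicts the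
    quadratic inequality. *)
Lemma upper_tail_norm (k : nat) (M : T -> R) :
    measurable_fun setT M -> (forall i w, X i w <= M w) ->
    (forall w, 0 <= M w) ->
  (qnorm P k.+1 (fun w => excess mu (Z w)) <=
   sqrte ((2 * kappa R * k.+1%:R)%:E * qnorm P k.+1 M * mu%:E) +
   (kappa R * k.+1%:R)%:E * qnorm P k.+1 M)%E.
Proof.
move=> mM XM M0; have kappa1 := kappa_ge1 R.
have kq0 : 0 < kappa R * k.+1%:R by rewrite mulr_gt0// (lt_le_trans ltr01).
have := qnorm_ge0 P k.+1 M; case MmE : (qnorm P k.+1 M) => [m| |]// m0.
- have [x x0 [-> quad]] := excess_norm_quadratic mM XM M0 MmE.
  rewrite -!EFinM /= -EFinD lee_fin.
  rewrite lee_fin in m0.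
  set q : R := k.+1%:R in quad kq0 *.
  have q0 : 0 < q by rewrite ltr0n.
  have qm0 : 0 <= q * m by rewrite mulr_ge0// ltW.
  set r := Num.sqrt _.
  have r0 : 0 <= r by exact: sqrtr_ge0.
  have r2 : q * m * mu <= r ^+ 2.
    rewrite /r; have -> : 2 * kappa R * q * m * mu = 2 * kappa R * (q * m * mu) by ring.
    have qmm0 : 0 <= q * m * mu by rewrite mulr_ge0.
    rewrite sqr_sqrtr; last by rewrite mulr_ge0//; lra.
    by apply: ler_peMl => //; lra.
  have s1 : q * m <= kappa R * q * m.
    by rewrite -mulrA; exact: ler_peMl.
  apply: (@le_trans _ _ (r + q * m)); last by rewrite lerD2l.
  rewrite leNgt; apply/negP => xlt; nra.
- rewrite [X in (_ + X)%E]gt0_muley ?lte_fin// addeC addye ?leey//.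
  by rewrite gt_eqF// (lt_le_trans _ (sqrte_ge0 _)).
Qed.

(** The bound on x comes from completing the square:
    (x - s/2)^2 <= s mu + s^2 / 4 <= (theta mu + s / (2 theta))^2, s = q m. *)
Lemma norm_sum_le (k : nat) (M : T -> R) (theta : R) :
    measurable_fun setT M -> (forall i w, X i w <= M w) ->
    (forall w, 0 <= M w) -> 0 < theta <= 1 ->
  (qnorm P k.+1 Z <= (1 + theta)%:E * mu%:E +
   (kappa R / 2 * k.+1%:R * (1 + theta^-1))%:E * qnorm P k.+1 M)%E.
Proof.
move=> mM XM M0 /andP[t0 tle1]; have kappa1 := kappa_ge1 R.
have t1 : 0 < 1 + theta^-1 by rewrite addr_gt0// invr_gt0.
have kq0 : 0 < kappa R / 2 * k.+1%:R * (1 + theta^-1).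
  by rewrite mulr_gt0// mulr_gt0// divr_gt0// (lt_le_trans ltr01 kappa1).
have := qnorm_ge0 P k.+1 M; case MmE : (qnorm P k.+1 M) => [m| |]// m0; last first.
  by rewrite gt0_muley ?lte_fin// -EFinM addey ?leey.
have [x x0 [Dx quad]] := excess_norm_quadratic mM XM M0 MmE.
have mD : measurable_fun setT (fun w => excess mu (Z w)).
  by apply: measurableT_comp => //; exact: measurable_excess.
apply: (@le_trans _ _ (x%:E + mu%:E)%E).
  rewrite -Dx -(qnorm_cst P k mu0).
  apply: le_trans (minkowski_EFin _ mD (measurable_cst mu) _); last first.
    by rewrite ler1n.
  have [|y y0 [Dy Iy]] := @qnorm_fin_moment _ _ _ P k
      (fun w => excess mu (Z w) + mu) (fun w => addr_ge0 (excess_ge0 _ _) mu0).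
    apply: le_lt_trans (minkowski_EFin _ mD (measurable_cst mu) _) _.
      by rewrite ler1n.
    by rewrite -/(qnorm P k.+1 _) -/(qnorm P k.+1 (cst mu)) qnorm_cst// Dx -EFinD ltry.
  rewrite -/(qnorm P k.+1 (fun w => excess mu (Z w) + mu)) Dy.
  apply: qnorm_le => //; rewrite -Iy; apply: ge0_le_integral => //.
  - by move=> w _; rewrite lee_fin exprn_ge0.
  - by apply/measurable_EFinP; exact: measurable_funX.
  - apply/measurable_EFinP; apply: measurable_funX.
    exact: measurable_funD.
  - move=> w _; rewrite lee_fin lerXn2r ?nnegrE ?addr_ge0 ?excess_ge0//.
    by rewrite -lerBlDr le_max lexx.
rewrite -!EFinM -!EFinD lee_fin; rewrite lee_fin in m0.
set q : R := k.+1%:R in quad kq0 *.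
have q0 : 0 < q by rewrite ltr0n.
set s := q * m in quad.
have s0 : 0 <= s by rewrite mulr_ge0// ltW.
rewrite mulrDl mul1r addrC -addrA lerD2l.
apply: (@le_trans _ _ (theta * mu + s / 2 * (1 + theta^-1))); last first.
  rewrite lerD2l /s.
  have -> : kappa R / 2 * q * (1 + theta^-1) * m =
    kappa R * (q * m / 2 * (1 + theta^-1)) by ring.
  by apply: ler_peMl => //; rewrite mulr_ge0 ?(ltW t1)// divr_ge0.
have sq : (x - s / 2) ^+ 2 <= (theta * mu + s / 2 * theta^-1) ^+ 2.
  have -> : (theta * mu + s / 2 * theta^-1) ^+ 2 =
      s * mu + (theta * mu) ^+ 2 + s ^+ 2 / 4 * theta^-1 ^+ 2.
    by field; rewrite gt_eqF.
  have : s ^+ 2 / 4 <= s ^+ 2 / 4 * theta^-1 ^+ 2.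
    apply: ler_peMr; first by rewrite divr_ge0 ?sqr_ge0.
    by rewrite exprn_ege1// invf_ge1.
  have := sqr_ge0 (theta * mu); nra.
have b0 : 0 <= theta * mu + s / 2 * theta^-1.
  by rewrite addr_ge0 ?mulr_ge0 ?invr_ge0// ltW.
have : x - s / 2 <= theta * mu + s / 2 * theta^-1.
  by rewrite leNgt; apply/negP => xlt; nra.
lra.
Qed.

(** The moment bound is used with v + eps, which covers v = 0. *)
Lemma lower_tail_norm (k : nat) :
  (qnorm P k.+1 (fun w => excess 0 (mu - Z w)) <=
   sqrte ((bigK R * k.+1%:R)%:E * \sum_i \int[P]_w (X i w ^+ 2)%:E))%E.
Proof.
have K0 : 0 < bigK R.
  by apply: lt_le_trans (bigK_ge R); rewrite divr_gt0 ?expR_gt0.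
have Kq0 : 0 < bigK R * k.+1%:R by rewrite mulr_gt0.
have I0 i : (0 <= \int[P]_w (X i w ^+ 2)%:E)%E.
  by apply: integral_ge0 => w _; rewrite lee_fin sqr_ge0.
have : (0 <= \sum_i \int[P]_w (X i w ^+ 2)%:E)%E by exact: sume_ge0.
case vE : (\sum_i \int[P]_w (X i w ^+ 2)%:E)%E => [v| |]// v0; last first.
  by rewrite gt0_muley ?lte_fin//= leey.
have fin i : (\int[P]_w (X i w ^+ 2)%:E)%E \is a fin_num.
  rewrite ge0_fin_numE//; apply: le_lt_trans (ltry v).
  by rewrite -vE (bigD1 i)//= leeDl// sume_ge0.
pose s i := fine (\int[P]_w (X i w ^+ 2)%:E)%E.
have EX2 i : (\int[P]_w (X i w ^+ 2)%:E = (s i)%:E)%E by rewrite fineK.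
have sv : \sum_i s i = v.
  by apply: EFin_inj; rewrite -vE -sumEFin; apply: eq_bigr => i _; rewrite EX2.
have L0 w : 0 <= excess 0 (mu - Z w) by exact: excess_ge0.
have bound eps : 0 < eps -> (qnorm P k.+1 (fun w => excess 0 (mu - Z w)) <=
    (Num.sqrt (bigK R * k.+1%:R * (v + eps)))%:E)%E.
  move=> eps0; apply: qnorm_le => //.
  rewrite lee_fin in v0.
  apply: (lower_moment_le mX X0 indX EX EX2); first exact: ltr_wpDl.
  by rewrite sv lerDl ltW.
have := qnorm_ge0 P k.+1 (fun w => excess 0 (mu - Z w)).
have := bound 1 ltr01.
case: (qnorm _ _ _) bound => [x| |]// bound _; rewrite lee_fin => x0.
rewrite lee_fin in v0.
rewrite -EFinM /= lee_fin -(ger0_norm x0) -sqrtr_sqr ler_wsqrtr//.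
apply/ler_addgt0Pr => eps eps0.
have := bound (eps / (bigK R * k.+1%:R)) (divr_gt0 eps0 Kq0).
rewrite lee_fin mulrDr [X in Num.sqrt (_ + X)]mulrC divfK ?gt_eqF// => xs.
have pos : 0 <= bigK R * k.+1%:R * v + eps.
  by rewrite addr_ge0 ?(ltW eps0)// mulr_ge0// ltW.
by rewrite -[leRHS]sqr_sqrtr// lerXn2r ?nnegrE ?sqrtr_ge0.
Qed.

End nonnegative_sums.

(** * The moment inequalities *)

Lemma measurable_bigmax0 (d : measure_display) (T : measurableType d)
    (R : realType) (I : Type) (r : seq I) (Y : I -> T -> R) :
    (forall i, measurable_fun setT (Y i)) ->
  measurable_fun setT (fun w => \big[Num.max/0]_(i <- r) Y i w).
Proof.
move=> mY; elim: r => [|i r IH].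
  by under eq_fun do rewrite big_nil; exact: measurable_cst.
by under eq_fun do rewrite big_cons; exact: measurable_maxr.
Qed.

(* The maxima are taken with default value 0: this is the genuine maximum since
   the entries are (almost surely) nonnegative, and 0 for the empty family. *)
Theorem theorem8 (d : measure_display) (T : measurableType d) (R : realType)
    (P : probability T R) (n : nat) (X : 'I_n -> {RV P >-> R})
    (X_indep : mutually_independent P X)
    (X_ge0 : forall i, {ae P, forall w, 0 <= X i w})
    (X_int : forall i, P.-integrable [set: T] (EFin \o X i))
    (q : nat) (q_ge1 : (1 <= q)%N) (theta : R) (theta01 : 0 < theta < 1) :
  let Z : T -> R := fun w => \sum_(i < n) X i w in
  let EZ : \bar R := ('E_P[Z])%E in
  let Dev : T -> R := fun w => Z w - fine EZ in
  let Mabs : T -> R := fun w => \big[Num.max/0]_(i < n) `|X i w| in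
  let M : T -> R := fun w => \big[Num.max/0]_(i < n) X i w in
  [/\ (qnorm P q Dev^\+%R <=
         sqrte ((2 * kappa R * q%:R)%:E * qnorm P q Mabs * EZ) +
         (kappa R * q%:R)%:E * qnorm P q Mabs)%E,
      (qnorm P q Dev^\-%R <=
         sqrte ((bigK R * q%:R)%:E *
                \sum_(i < n) 'E_P[fun w => (X i w ^+ 2)%R]))%E
    & (qnorm P q Z <=
         (1 + theta)%:E * EZ +
         (kappa R / 2 * q%:R * (1 + theta^-1))%:E * qnorm P q M)%E ].
Proof.
move=> Z EZ Dev Mabs M; have /andP[t0 t1] := theta01.
case: q q_ge1 => // k _.
have mX i : measurable_fun setT (X i) by exact: measurable_funPT.
(* The positive part of X_i. *)
pose Y i := excess 0 \o X i.
have mY i : measurable_fun setT (Y i).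
  by apply: measurableT_comp => //; exact: measurable_excess.
have Y0 i w : 0 <= Y i w by exact: excess_ge0.
have indY : independent_family P Y.
  by apply: independent_family_comp X_indep; exact: measurable_excess.
have XY : \forall w \ae P, forall i, X i w = Y i w.
  apply: filter_forall => i; apply: filterS (X_ge0 i) => w Xw.
  by rewrite /Y /= /excess subr0; apply/esym/max_idPl.
have mZ : measurable_fun setT Z by exact: measurable_sum.
pose ZY w := \sum_i Y i w.
have mZY : measurable_fun setT ZY by exact: measurable_sum.
have ZZY : \forall w \ae P, Z w = ZY w.
  by apply: filterS XY => w XYw; apply: eq_bigr => i _.
pose MY w := \big[Num.max/0]_(i < n) Y i w.
have mMY : measurable_fun setT MY by exact: measurable_bigmax0.
have YMY i w : Y i w <= MY w by apply: le_bigmax.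
have MY0 w : 0 <= MY w by apply: bigmax_ge_id.
have qM : qnorm P k.+1 M = qnorm P k.+1 MY.
  apply: qnorm_ae_eq => //; first exact: measurable_bigmax0.
  by apply: filterS XY => w XYw; apply: eq_bigr => i _.
have qMabs : qnorm P k.+1 Mabs = qnorm P k.+1 MY.
  apply: qnorm_ae_eq => //.
    by apply: measurable_bigmax0 => i; exact: measurableT_comp.
  by apply: filterS XY => w XYw; apply: eq_bigr => i _; rewrite XYw ger0_norm.
have EXY i : (\int[P]_w (X i w)%:E = \int[P]_w (Y i w)%:E)%E.
  apply: ae_eq_integral => //; try exact/measurable_EFinP.
  by apply: filterS XY => w /(_ i) /= -> _.
pose e i := fine (\int[P]_w (Y i w)%:E)%E.
have EY i : (\int[P]_w (Y i w)%:E = (e i)%:E)%E.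
  by rewrite /e fineK// -EXY; apply: integrable_fin_num => //; exact: X_int.
have EZE : EZ = (\sum_i e i)%:E.
  rewrite /EZ unlock -sumEFin; under [RHS]eq_bigr do rewrite -EY -EXY.
  rewrite -(integral_sum measurableT X_int).
  by apply: eq_integral => w _; rewrite sumEFin.
have mDev : measurable_fun setT Dev by exact: measurable_funB.
split.
- rewrite qMabs EZE.
  have -> : qnorm P k.+1 Dev^\+%R =
      qnorm P k.+1 (fun w => excess (\sum_i e i) (ZY w)).
    apply: qnorm_ae_eq.
    + exact: measurable_funrpos.
    + by apply: measurableT_comp => //; exact: measurable_excess.
    + by apply: filterS ZZY => w Zw; rewrite /funrpos /Dev EZE /= Zw.
  exact: upper_tail_norm.
- have -> : qnorm P k.+1 Dev^\-%R =
      qnorm P k.+1 (fun w => excess 0 (\sum_i e i - ZY w)).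
    apply: qnorm_ae_eq.
    + exact: measurable_funrneg.
    + apply: measurableT_comp; first exact: measurable_excess.
      exact: measurable_funB.
    + apply: filterS ZZY => w Zw.
      by rewrite /funrneg /Dev EZE /= Zw opprB /excess subr0.
  have -> : (\sum_(i < n) 'E_P[fun w => (X i w ^+ 2)%R] =
      \sum_i \int[P]_w (Y i w ^+ 2)%:E)%E.
    apply: eq_bigr => i _; rewrite unlock.
    apply: ae_eq_integral => //; try by apply/measurable_EFinP; exact: measurable_funX.
    by apply: filterS XY => w /(_ i) /= -> _.
  exact: lower_tail_norm.
- rewrite qM EZE.
  have -> : qnorm P k.+1 Z = qnorm P k.+1 ZY by exact: qnorm_ae_eq.
  by apply: norm_sum_le => //; rewrite t0 ltW.
Qed.
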